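(* The minimum size of a universal instance is $12$: every universal instance has size at least $12$, and there exists a universal instance of size $12$.
   Context: Fix a palette of six distinct colors. A (colored) cube is a unit cube each of whose six faces is painted with exactly one color of the palette, all six faces receiving different colors. Two colored cubes have the same variety if one can be rotated onto the other; there are exactly 30 varieties. An instance is a finite multiset of colored cubes (several cubes of the same variety are allowed); its size is the number of cubes counted with multiplicity. A solid is a $2\times2\times2$ cube assembled from eight colored unit cubes such that each of its six outer $2\times2$ faces is of a single color and the six outer faces have six different colors; its variety is defined as for unit cubes. A solid of variety $v$ is composable from an instance $I$ if some eight cubes of $I$ can be placed and oriented to form a solid of variety $v$. An instance is universal if a solid of every one of the 30 varieties is composable from it. *)

(* Defs.v *)
From HB Require Import structures.
From mathcomp Require Import all_boot all_fingroup all_algebra.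
From mathcomp Require Import finmap multiset.

Set Implicit Arguments.
Unset Strict Implicit.
Unset Printing Implicit Defensive.

Import GRing.Theory.
Local Open Scope mset_scope.
Local Open Scope nat_scope.

Definition color := 'I_6.

(* (i, b) is the face orthogonal to axis i, on the positive side of the cube
   if b = false and on the negative side if b = true. *)
Definition face : finType := ('I_3 * bool)%type.

Definition normal (f : face) : 'rV[int]_3 :=
  ((-1) ^+ f.2 *: delta_mx ord0 f.1)%R.

(* A colored cube in a definite orientation: with six faces and six colors,
   injectivity says that the six faces receive different colors. *)
Record cube := Cube {
  paint :> {ffun face -> color};
  paint_inj : injectiveb paint
}.

HB.instance Definition _ := [isSub for paint].
HB.instance Definition _ := [Finite of cube by <:].

(* The only linear map that can induce g on the six outward normals sends the
   i-th basis vector to the normal of g (i, false); g comes from a rotation of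
   the cube iff this map does induce g and has determinant 1 (it is then
   automatically orthogonal). *)
Definition face_mx (g : {perm face}) : 'M[int]_3 :=
  (\matrix_(i < 3) normal (g (i, false)))%R.

Definition is_rotation (g : {perm face}) : bool :=
  [forall f, normal (g f) == (normal f *m face_mx g)%R]
  && (\det (face_mx g) == 1)%R.

(* d results from rotating c by g: face f is carried to face g f. *)
Definition same_variety (c d : cube) : bool :=
  [exists g : {perm face}, is_rotation g && [forall f, d (g f) == c f]].

Definition variety (c : cube) : {set cube} := [set d | same_variety c d].

Definition varieties : {set {set cube}} := [set variety c | c : cube].

(* The eight unit positions of the 2x2x2 cube: p i tells on which side of the
   mid-plane orthogonal to axis i the position lies, with the sign convention
   of faces. *)
Definition position : finType := {ffun 'I_3 -> bool}.

Definition on_outer_face (p : position) (f : face) : bool := p f.1 == f.2.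

(* q gives the oriented cube standing at each position. Its outer 2x2 faces
   are monochromatic, with colors given by w; these are pairwise different
   since w is a cube. *)
Definition is_solid (q : position -> cube) (w : cube) : Prop :=
  forall (p : position) (f : face), on_outer_face p f -> q p f = w f.

(* An instance is a multiset I of cubes, of size (size I). k p is the cube of I
   chosen for position p, and q p is k p as oriented there; v is a variety,
   i.e. an element of varieties. *)
Definition composable (I : {mset cube}) (v : {set cube}) : Prop :=
  exists (k q : position -> cube) (w : cube),
    [/\ seq_mset [seq k p | p : position] `<=` I,
        forall p, same_variety (k p) (q p),
        is_solid q w
      & variety w = v].

Definition universal (I : {mset cube}) : Prop :=
  forall v, v \in varieties -> composable I v.

(* Main.v *)
(* A cube can serve at a corner of a solid of variety w iff it shares with w
   that corner, i.e. the same cyclic order of the same three colors.  A cube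
   shares a corner with only 21 of the 30 varieties (504 of the 720 oriented
   cubes), while every solid uses eight cubes sharing a corner with it.  Double
   counting gives 720 * 8 <= 504 * size I, i.e. size I >= 11.43.  Conversely,
   for twelve explicit cubes, found by local search, a matching of the eight
   corners to the cubes is found for each of the 720 oriented solids. *)
From mathcomp Require Import all_boot all_fingroup all_algebra ring.
From mathcomp Require Import finmap multiset.
Require Import Defs.

Set Implicit Arguments.
Unset Strict Implicit.
Unset Printing Implicit Defensive.

Import GRing.Theory.
Local Open Scope nat_scope.

(** * Executable encodings of faces, corners and orientation *)

Definition axis (k : nat) : 'I_3 := inZp k.

Definition faces : seq face :=
  [seq (axis k, b) | k <- iota 0 3, b <- [:: false; true]].

Definition colors : seq color := [seq inZp k | k <- iota 0 6].

(** Boolean triples stand for positions in computations; [bit] and [octant_of] translate between the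
    two. *)
Definition octants : seq (bool * bool * bool) :=
  let bits := [:: false; true] in
  [seq (ab, c) | ab <- [seq (a, b) | a <- bits, b <- bits], c <- bits].

Definition bit (t : bool * bool * bool) (i : 'I_3) : bool :=
  nth false [:: t.1.1; t.1.2; t.2] i.

Definition flip (b : bool) (f : face) : face := (f.1, f.2 (+) b).

Definition coord (f : face) (i : 'I_3) : int :=
  (if f.1 == i then if f.2 then -1 else 1 else 0)%R.

Definition det3 (f g h : face) : int :=
  let x0 := axis 0 in let x1 := axis 1 in let x2 := axis 2 in
  (coord f x0 * (coord g x1 * coord h x2 - coord g x2 * coord h x1)
   - coord f x1 * (coord g x0 * coord h x2 - coord g x2 * coord h x0)
   + coord f x2 * (coord g x0 * coord h x1 - coord g x1 * coord h x0))%R.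

(* det3 f g h = 1, in a form that is cheaper to compute. *)
Definition right_handed (f g h : face) : bool :=
  let: (a, b, c) := (f.1 : nat, g.1 : nat, h.1 : nat) in
  if (b == a.+1 %% 3) && (c == a.+2 %% 3) then ~~ (f.2 (+) g.2 (+) h.2)
  else if (b == a.+2 %% 3) && (c == a.+1 %% 3) then f.2 (+) g.2 (+) h.2
  else false.

(* s lists the images of faces.  Flipping the i-th image when p i holds replaces
   the corner p by the positive octant, whatever the orientation of p. *)
Definition oriented (s : seq face) (p : 'I_3 -> bool) : bool :=
  let y k := flip (p (axis k))
               (nth (ord0, false) s (index (axis k, p (axis k)) faces)) in
  right_handed (y 0) (y 1) (y 2).

(** With [l] the code of a cube, this is the inverse of its painting. *)
Definition locate (l : seq color) (k : color) : face :=
  nth (ord0, false) faces (index k l).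

(* Nested conditionals instead of has and &&, which vm_compute would evaluate
   without cutting off the search. *)
Fixpoint assignable (P : Type) (T : eqType) (ok : P -> pred T)
    (ps : seq P) (s : seq T) : bool :=
  if ps is p :: ps' then
    foldr (fun x found => if found then true else
             if ok p x then assignable ok ps' (rem x s) else false) false s
  else true.

(* Each cube is given by its colors in the order of faces. *)
Definition twelve : seq (seq color) := map (map inZp) [::
  [:: 0; 1; 2; 3; 4; 5]; [:: 0; 1; 2; 3; 5; 4];
  [:: 0; 1; 2; 4; 3; 5]; [:: 0; 1; 2; 4; 5; 3];
  [:: 0; 3; 1; 2; 4; 5]; [:: 0; 3; 1; 2; 5; 4];
  [:: 0; 3; 1; 5; 2; 4]; [:: 0; 3; 1; 5; 4; 2];
  [:: 0; 4; 1; 2; 3; 5]; [:: 0; 4; 1; 2; 5; 3];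
  [:: 0; 4; 1; 5; 2; 3]; [:: 0; 4; 1; 5; 3; 2]].

(** Generalizes [face_mx] to three prescribed images, before they are known to extend to a
    permutation of the faces. *)
Definition frame (x : 'I_3 -> face) : 'M[int]_3 := (\matrix_i normal (x i))%R.

(** * Face normals and determinants *)

Lemma mem_faces f : f \in faces.
Proof. by case: f => [[[|[|[|//]]] lt_i] []]; rewrite !inE. Qed.

Lemma axisE (i : 'I_3) : axis i = i.
Proof. by apply: val_inj; rewrite /= modn_small. Qed.

Lemma normalE f i : normal f ord0 i = coord f i.
Proof.
rewrite !mxE /coord eqxx /= eq_sym; case: eqP => _; last by rewrite mulr0.
by rewrite mulr1; case: f.2.
Qed.

Lemma normal_inj : injective normal.
Proof.
move=> f g /rowP eq_n.
have eq_c i : coord f i = coord g i by rewrite -!normalE eq_n.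
have := eq_c f.1; rewrite /coord eqxx.
case: f g {eq_n eq_c} => [i a] [j b] /=; case: eqP => [->|_]; last by case: a.
by case: a b => [] [].
Qed.

Lemma normal_flip b f : normal (flip b f) = ((-1) ^+ b *: normal f)%R.
Proof. by rewrite /normal /= scalerA addbC signr_addb. Qed.

Lemma det_mx33 (R : comPzRingType) (M : 'M[R]_3) :
  let m i j := M (axis i) (axis j) in
  (\det M = m 0 0 * (m 1 1 * m 2 2 - m 1 2 * m 2 1)
           - m 0 1 * (m 1 0 * m 2 2 - m 1 2 * m 2 0)
           + m 0 2 * (m 1 0 * m 2 1 - m 1 1 * m 2 0))%R.
Proof.
move=> m; have mE i j : M i j = m i j by rewrite /m !axisE.
rewrite (expand_det_row _ ord0) !big_ord_recl big_ord0 /cofactor.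
rewrite !(expand_det_row _ ord0) !big_ord_recl !big_ord0 /cofactor !det_mx11.
by rewrite !mxE !mE /= /bump /=; ring.
Qed.

(** Only three faces matter, so after cofactor expansion all 216 triples are checked by
    computation. *)
Lemma det_frame_eq1 x :
  (\det (frame x) == 1)%R =
    right_handed (x (axis 0)) (x (axis 1)) (x (axis 2)).
Proof.
have frameE i j : frame x i j = coord (x i) j by rewrite !mxE -normalE !mxE.
rewrite det_mx33 !frameE -/(det3 (x (axis 0)) (x (axis 1)) (x (axis 2))).
move: (x _) (x _) (x _) => h g f.
have chk : all (fun f => all (fun g => all (fun h =>
    (det3 f g h == 1%R) == right_handed f g h) faces) faces) faces.
  by vm_compute.
move/allP: chk => /(_ f (mem_faces f))/allP/(_ g (mem_faces g))/allP.
by move=> /(_ h (mem_faces h))/eqP.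
Qed.

Lemma flip_flip a b f : flip a (flip b f) = flip (b (+) a) f.
Proof. by case: f => i c; rewrite /flip /= addbA. Qed.

Lemma row_frame i x : row i (frame x) = normal (x i).
Proof. exact: rowK. Qed.

Lemma mul_frame x f : (normal f *m frame x)%R = normal (flip f.2 (x f.1)).
Proof. by rewrite -scalemxAl -rowE row_frame normal_flip. Qed.

(** * Rotations of the cube *)

Lemma rotation_flip g b f : is_rotation g -> g (flip b f) = flip b (g f).
Proof.
case/andP=> /forallP g_lin _; apply: normal_inj.
by rewrite normal_flip !(eqP (g_lin _)) normal_flip scalemxAl.
Qed.

Lemma rotation1 : is_rotation 1%g.
Proof.
have fm1 : face_mx 1 = 1%:M%R.
  by apply/row_matrixP => i; rewrite rowK perm1 row1 /normal scale1r.
rewrite /is_rotation fm1 det1 eqxx andbT.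
by apply/forallP => f; rewrite perm1 mulmx1.
Qed.

Lemma rotationM g h : is_rotation g -> is_rotation h -> is_rotation (g * h)%g.
Proof.
case/andP=> /forallP g_lin /eqP g_det /andP[/forallP h_lin /eqP h_det].
have fmM : face_mx (g * h) = (face_mx g *m face_mx h)%R.
  by apply/row_matrixP => i; rewrite row_mul !rowK permM (eqP (h_lin _)).
rewrite /is_rotation fmM det_mulmx g_det h_det mulr1 eqxx andbT.
apply/forallP => f; rewrite permM mulmxA.
by rewrite (eqP (h_lin _)) (eqP (g_lin _)).
Qed.

Lemma rotationV g : is_rotation g -> is_rotation g^-1%g.
Proof.
case/andP=> /forallP g_lin /eqP g_det.
have g_unit : face_mx g \in unitmx by rewrite unitmxE g_det unitr1.
have linV f : normal (g^-1%g f) = (normal f *m invmx (face_mx g))%R.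
  by rewrite -{2}[f](permKV g) (eqP (g_lin _)) mulmxK.
have fmV : face_mx g^-1 = invmx (face_mx g).
  by apply/row_matrixP => i; rewrite rowK linV /normal scale1r -rowE.
rewrite /is_rotation fmV det_inv g_det invr1 eqxx andbT.
by apply/forallP => f; rewrite linV.
Qed.

(** By linearity a rotation is determined by the images of the three faces at a corner, and flipping
    turns these into the images of the positive faces, the rows of [face_mx]. *)
Lemma corner_rotationP (x : 'I_3 -> face) (p : 'I_3 -> bool) :
  reflect (exists2 g, is_rotation g & forall i, g (i, p i) = x i)
          (\det (frame (fun i => flip (p i) (x i))) == 1)%R.
Proof.
apply: (iffP eqP) => [x_det | [g g_rot gx]]; last first.
  rewrite -(eqP (proj2 (andP g_rot))); congr (\det _)%R.
  apply/row_matrixP => i; rewrite row_frame rowK -gx -rotation_flip //.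
  by rewrite /flip /= addbb.
set y := (fun i => flip (p i) (x i)) in x_det.
(* The images [y] of the positive faces extend to all faces by oddness; invertibility of [frame y]
   makes the extension injective, hence a permutation. *)
pose h f := flip f.2 (y f.1).
have y_unit : frame y \in unitmx by rewrite unitmxE x_det unitr1.
have h_inj : injective h.
  move=> f f' eq_h; apply: normal_inj.
  by apply: (can_inj (mulmxK y_unit)); rewrite !mul_frame -/(h f) eq_h.
have fmh : face_mx (perm h_inj) = frame y.
  apply/row_matrixP => i; rewrite !rowK permE /h /=.
  by case: (y i) => a b; rewrite /flip /= addbF.
exists (perm h_inj).
  rewrite /is_rotation fmh x_det eqxx andbT.
  by apply/forallP => f; rewrite permE mul_frame.
move=> i; rewrite permE /h /y flip_flip addbb.
by case: (x i) => a b; rewrite /flip addbF.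
Qed.

(** * Color codes and shared corners *)

Lemma cube_inj (c : cube) : injective c.
Proof. exact/injectiveP/paint_inj. Qed.

Definition code (c : cube) : seq color := map c faces.

Lemma code_uniq c : uniq (code c).
Proof. by rewrite map_inj_uniq //; exact: cube_inj. Qed.

Lemma mem_code c k : k \in code c.
Proof.
have /codomP[f ->] : k \in codom c.
  apply: inj_card_onto; first exact: cube_inj.
  by rewrite card_prod card_bool !card_ord.
exact/map_f/mem_faces.
Qed.

Lemma code_colors c : code c \in permutations colors.
Proof.
rewrite mem_permutations uniq_perm ?code_uniq // => k; rewrite mem_code.
by apply/esym/mapP; exists (k : nat); rewrite ?mem_iota //= valZpK.
Qed.

Lemma code_inj : injective code.
Proof.
move=> c d eq_cd; apply/val_inj/ffunP => f.
have := congr1 (fun s => nth ord0 s (index f faces)) eq_cd.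
have f_lt : index f faces < size faces by rewrite index_mem mem_faces.
by rewrite !(nth_map (ord0, false)) // nth_index ?mem_faces.
Qed.

Lemma locateK c f : locate (code c) (c f) = f.
Proof.
by rewrite /locate index_map ?nth_index ?mem_faces //; exact: cube_inj.
Qed.

Lemma paint_locate (c : cube) k : c (locate (code c) k) = k.
Proof.
by have /mapP[f _ ->] := mem_code c k; rewrite locateK.
Qed.

(** The list sends each face of [w] to the face of [c] of the same color; [oriented] tests whether
    some rotation agrees with this map on the three faces at [p]. *)
Definition fits (c w : cube) (p : 'I_3 -> bool) : bool :=
  oriented (map (locate (code c)) (code w)) p.

Lemma fitsP (c w : cube) (p : position) :
  reflect (exists2 q, same_variety c q &
             forall f, on_outer_face p f -> q f = w f)
          (fits c w p).
Proof.
pose x i := locate (code c) (w (i, p i)).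
have -> : fits c w p = (\det (frame (fun i => flip (p i) (x i))) == 1)%R.
  rewrite det_frame_eq1 /fits /oriented /x /code -map_comp.
  have nthE f : nth (ord0, false)
      (map (locate (map c faces) \o w) faces) (index f faces)
      = locate (map c faces) (w f).
    by rewrite (nth_map (ord0, false)) ?nth_index ?index_mem ?mem_faces.
  by rewrite !nthE.
apply: (iffP (corner_rotationP x p)) => [[g g_rot gx] | [q]].
  (* Giving [f] the color of [g f] in [c] amounts to rotating [c] by the inverse of [g]. *)
  have q_inj : injectiveb [ffun f => c (g f)].
    by apply/injectiveP => f f'; rewrite !ffunE => /cube_inj/perm_inj.
  exists (Cube q_inj).
    apply/existsP; exists g^-1%g; rewrite rotationV //.
    by apply/forallP => f; rewrite ffunE permKV.
  move=> [i b]; rewrite /on_outer_face /= => /eqP <-.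
  by rewrite ffunE gx /x paint_locate.
case/existsP=> g /andP[g_rot /forallP qg] q_w.
exists g^-1%g => [|i]; first exact: rotationV.
rewrite /x -q_w /on_outer_face //= -{2}[(i, p i)](permKV g) (eqP (qg _)).
by rewrite locateK.
Qed.

Lemma same_variety_refl c : same_variety c c.
Proof.
apply/existsP; exists 1%g; rewrite rotation1.
by apply/forallP => f; rewrite perm1.
Qed.

Definition meets (c w : cube) : bool := [exists p : position, fits c w p].

(** Rotations carry corners to corners, so a corner shared with [w'] is pulled back along the
    rotation from [w] to [w']. *)
Lemma meets_same_variety c w w' : same_variety w w' -> meets c w' -> meets c w.
Proof.
case/existsP=> g /andP[g_rot /forallP w'g] /existsP[p /fitsP[q]].
case/existsP=> h /andP[h_rot /forallP qh] q_w'.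
have outerC i b : on_outer_face p (g (i, ~~ b)) = ~~ on_outer_face p (g (i, b)).
  have -> : (i, ~~ b) = flip true (i, b) by rewrite /flip /= addbT.
  rewrite rotation_flip // /on_outer_face /= addbT.
  by case: (p _) (g _).2 => [] [].
(* Opposite faces have opposite images, so on each axis exactly one face is carried by [g] to a face
   at [p]; [p'] selects it. *)
pose p' : position := [ffun i => ~~ on_outer_face p (g (i, false))].
have q_inj : injectiveb [ffun f => q (g f)].
  by apply/injectiveP => f f'; rewrite !ffunE => /cube_inj/perm_inj.
apply/existsP; exists p'; apply/fitsP; exists (Cube q_inj).
  apply/existsP; exists (h * g^-1)%g; rewrite rotationM ?rotationV //.
  by apply/forallP => f; rewrite ffunE permM permKV.
move=> [i b] p'_ib; rewrite ffunE q_w' ?(eqP (w'g _)) //.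
move: p'_ib; rewrite /on_outer_face -/(on_outer_face p (g (i, b))) /= ffunE.
by case: b; rewrite ?(outerC i false); case: on_outer_face.
Qed.

Definition octant_of (p : position) : bool * bool * bool :=
  (p (axis 0), p (axis 1), p (axis 2)).

Lemma bit_octant p : bit (octant_of p) =1 p.
Proof. by move=> i; rewrite -(axisE i); case: i => [[|[|[|//]]] lt_i]. Qed.

Lemma mem_octants t : t \in octants.
Proof. by case: t => [[[] []] []]. Qed.

Lemma eq_oriented s p p' : p =1 p' -> oriented s p = oriented s p'.
Proof. by move=> eq_p; rewrite /oriented !eq_p. Qed.

(** * Double counting and the lower bound *)

Lemma card_cube : #|{: cube}| = 720.
Proof.
rewrite card_sub -[RHS]/(6 ^_ 6).
have -> : 6 ^_ 6 = #|color| ^_ #|face|.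
  by rewrite card_prod card_bool !card_ord.
by rewrite -card_inj_ffuns; apply: eq_card => f; rewrite !inE.
Qed.

(** Each list describes one cube relative to another, so a single evaluation over 720 lists serves
    every choice of the fixed cube. *)
Lemma count_oriented :
  count (fun s => has (fun t => oriented s (bit t)) octants)
        (permutations faces) = 504.
Proof. by vm_cast_no_check (erefl 504). Qed.

(** Composing the painting of [w] with the inverse of that of [c] is injective in [w] and yields a
    list counted by [count_oriented]. *)
Lemma card_meets c : #|[set w | meets c w]| <= 504.
Proof.
pose rel w := map (locate (code c)) (code w).
have rel_inj : injective rel.
  move=> w w' /(congr1 (map c)).
  by rewrite !(mapK (paint_locate c)) => /code_inj.
rewrite -count_oriented -size_filter cardE -(size_map rel).
apply: uniq_leq_size => [|_ /mapP[w + ->]].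
  by rewrite map_inj_uniq ?enum_uniq.
rewrite mem_enum inE => /existsP[p fit_p].
rewrite mem_filter; apply/andP; split.
  apply/hasP; exists (octant_of p); first exact: mem_octants.
  by rewrite (eq_oriented _ (bit_octant p)).
rewrite mem_permutations uniq_perm // => [|f].
  rewrite map_inj_in_uniq ?code_uniq // => k k' _ _ /(congr1 c).
  by rewrite !paint_locate.
rewrite mem_faces; apply/mapP; exists (c f); first exact: mem_code.
by rewrite locateK.
Qed.

(** Comparing multiplicities makes [s] a permutation of a subsequence of [A], which bounds the count
    of any predicate. *)
Lemma count_msubset (T : choiceType) (a : pred T) (s : seq T)
    (A : {mset T}%mset) :
  (seq_mset s `<=` A)%mset -> count a s <= count a A.
Proof.
move/msubsetP=> sA; have /count_subseqP[s' s'A /seq.permP->] :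
    forall x, count_mem x s <= count_mem x A.
  by move=> x; rewrite -mset_seqE count_mem_mset.
exact: leq_count_subseq.
Qed.

(** The solid supplied by universality has its own orientation [w']; its eight cubes meet [w'],
    hence also [w]. *)
Lemma universal_count_meets (I : {mset cube}%mset) w :
  universal I -> 8 <= count (meets^~ w) I.
Proof.
case/(_ (variety w) (imset_f _ _)) => // k [q [w' [kI kq q_w' eq_var]]].
have ww' : same_variety w w'.
  have : w' \in variety w by rewrite -eq_var inE same_variety_refl.
  by rewrite inE.
apply: leq_trans (count_msubset _ kI).
rewrite count_map (@eq_count _ _ predT) => [|p] /=.
  by rewrite count_predT -cardE card_ffun card_bool card_ord.
apply: (meets_same_variety ww'); apply/existsP; exists p; apply/fitsP.
by exists (q p) => // f; exact: q_w'.
Qed.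

Lemma universal_size (I : {mset cube}%mset) : universal I -> 12 <= size I.
Proof.
move=> univ_I.
have lb : 720 * 8 <= \sum_w count (meets^~ w) I.
  rewrite -card_cube -sum_nat_const.
  by apply: leq_sum => w _; exact: universal_count_meets.
have ub : \sum_w count (meets^~ w) I <= size I * 504.
  under eq_bigr do rewrite -sum1_count.
  rewrite (exchange_big_dep predT) //= -sum1_size big_distrl /=.
  apply: leq_sum => c _; rewrite mul1n sum1dep_card; exact: card_meets.
(* The goal reads [11 < size I]; eleven cubes would give only 11 * 504 = 5544, less than 720 * 8 =
   5760. *)
by rewrite -(ltn_pmul2r (isT : 0 < 504)); apply: leq_trans (leq_trans lb ub).
Qed.

(** * Matching search and the universal instance *)

(** Soundness of the backtracking search: [rem] deletes one occurrence per choice, and [r] is what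
    remains of [s]. *)
Lemma assignableP (P T : eqType) (x0 : T) (ok : P -> pred T) ps s :
  uniq ps -> assignable ok ps s ->
  exists k : P -> T, exists2 r, perm_eq (map k ps ++ r) s
    & {in ps, forall p, ok p (k p)}.
Proof.
elim: ps s => [|p ps IH] s /=.
  by move=> _ _; exists (fun=> x0), s.
case/andP=> p_ps ps_uniq.
(* The fold is [has] in disguise. *)
have -> : forall s0, foldr (fun x found => if found then true else
    if ok p x then assignable ok ps (rem x s) else false) false s0
    = has (fun x => ok p x && assignable ok ps (rem x s)) s0.
  by elim=> //= x s0 ->; rewrite orbC; case: has.
case/hasP=> x xs /andP[ok_x /(IH _ ps_uniq)[k [r perm_r ok_k]]].
(* Since [p] does not recur in [ps], this update leaves the earlier choices intact. *)
pose k' p' := if p' == p then x else k p'.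
have /eq_in_map eq_k : {in ps, k' =1 k}.
  move=> p' p'_ps; rewrite /k'; case: eqP => // eq_p.
  by rewrite -eq_p p'_ps in p_ps.
exists k', r.
  rewrite eq_k {1}/k' eqxx.
  by rewrite perm_sym (perm_trans (perm_to_rem xs)) // perm_cons perm_sym.
by move=> p'; rewrite inE /k'; case: eqP => [-> // | _ /=]; exact: ok_k.
Qed.

Lemma code_surj l : uniq l -> size l = 6 -> exists c, code c = l.
Proof.
move=> l_uniq l_size; pose f := [ffun f : face => nth ord0 l (index f faces)].
have ltf g : index g faces < size l by rewrite l_size index_mem mem_faces.
have f_inj : injectiveb f.
  apply/injectiveP => g h; rewrite !ffunE => /eqP; rewrite nth_uniq // => /eqP.
  by move/(congr1 (nth (ord0, false) faces)); rewrite !nth_index ?mem_faces.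
exists (Cube f_inj); apply: (@eq_from_nth _ ord0) => [|i].
  by rewrite size_map l_size.
rewrite size_map => lt_i.
by rewrite (nth_map (ord0, false)) //= ffunE index_uniq.
Qed.

(** Here [r] holds the cubes left over, so the eight chosen ones form a sub-multiset; [fitsP]
    orients each of them separately. *)
Lemma composable_octants (I : {mset cube}%mset) (w : cube)
    (k : bool * bool * bool -> cube) r :
  perm_eq (map k octants ++ r) I -> (forall t, fits (k t) w (bit t)) ->
  composable I (variety w).
Proof.
move=> kI k_fits.
have k_ok (p : position) : exists2 q, same_variety (k (octant_of p)) q &
    forall f, on_outer_face p f -> q f = w f.
  by apply/fitsP; rewrite /fits -(eq_oriented _ (bit_octant p)); exact: k_fits.
have [q kq q_w] := fin_all_exists2 k_ok.
exists (k \o octant_of), q, w; split=> //.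
have oct_perm : perm_eq (map octant_of (enum position)) octants.
  apply: uniq_perm => // [|t].
    rewrite map_inj_uniq ?enum_uniq // => p p' eq_pp'.
    by apply/ffunP => i; rewrite -!bit_octant eq_pp'.
  rewrite mem_octants; apply/mapP; exists [ffun i => bit t i].
    by rewrite mem_enum.
  by case: t => [[a b] c]; rewrite /octant_of !ffunE.
apply/msubsetP => c.
rewrite mset_seqE -count_mem_mset -(seq.permP kI) count_cat.
by rewrite -(seq.permP (perm_map k oct_perm)) -map_comp; exact: leq_addr.
Qed.

(** Here [l] runs over the codes of all oriented solids, and the test is [fits] expressed on
    codes. *)
Lemma twelve_universal :
  all (fun l => assignable (fun t c => oriented (map (locate c) l) (bit t))
                  octants twelve)
      (permutations colors).
Proof. by vm_cast_no_check (erefl true). Qed.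

Theorem theorem4 :
  (forall I : {mset cube}%mset, universal I -> 12 <= size I) /\
  (exists I : {mset cube}%mset, universal I /\ size I = 12).
Proof.
split=> [I|]; first exact: universal_size.
(* Any cube serves as the default value of [decode]. *)
have [c0 _] := code_surj (isT : uniq colors) erefl.
pose decode l := odflt c0 [pick c | code c == l].
have decodeK l : l \in twelve -> code (decode l) = l.
  move=> l12; rewrite /decode; case: pickP => [c /eqP //|no_c].
  have /andP[l_uniq /eqP l_size] : uniq l && (size l == 6).
    by move: l l12 {no_c}; apply/allP; vm_compute.
  by have [c c_l] := code_surj l_uniq l_size; have := no_c c; rewrite c_l eqxx.
exists (seq_mset (map decode twelve)); split; last first.
  by rewrite (perm_size (perm_eq_seq_mset _)) size_map.
move=> v /imsetP[w _ ->].
have [k [r perm_r k_ok]] := assignableP [::] (isT : uniq octants)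
  (allP twelve_universal _ (code_colors w)).
(* As [octants] exhausts the triples, every value of [k] is one of the twelve codes, never the
   default [[::]], and can be decoded. *)
have k12 t : k t \in twelve.
  by rewrite -(perm_mem perm_r) mem_cat map_f ?mem_octants.
apply: (@composable_octants _ _ (decode \o k) (map decode r)) => [|t].
  rewrite map_comp -map_cat perm_sym (permPl (perm_eq_seq_mset _)) perm_sym.
  exact: perm_map.
by rewrite /fits /= decodeK //; apply: k_ok; exact: mem_octants.
Qed.
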